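(* Let $\mathcal T_{ij}$ be the (symmetric) components of the energy-momentum tensor of a non-ideal fluid with velocity $u$, normalized by $u_\alpha u^\alpha=1$, in a 4-dimensional spacetime whose symmetric metric part is $g_{\underline{ij}}=\mathrm{diag}(s_0(t),s_1(t),s_2(t),s_3(t))$, and let $\rho$ and $p$ be the energy density and pressure of the fluid as defined in the context. Then the pressure satisfies $$p=-\tfrac13\,\mathcal T_{\alpha\beta}\big(g^{\underline{\alpha\beta}}-u^\alpha u^\beta\big)=-\tfrac13\big(\mathcal T^\alpha_\alpha-\rho\big),$$ and in the comoving reference frame $u_i=\delta_{i0}$ it reduces to $$p=-\tfrac13\mathcal T^\alpha_\alpha+\tfrac13\mathcal T_{00}.$$ The energy density is $\rho=\mathcal T_{\alpha\beta}u^\alpha u^\beta$, and in the comoving reference frame it reduces to $\rho=\mathcal T_{00}$. Moreover, if $\omega$ is the state parameter defined by the equation of state $p=\omega\rho$, then, wherever $\rho\neq0$, $$\omega=-\tfrac13\,\mathcal T^\alpha_\alpha\big(\mathcal T_{\beta\gamma}u^\beta u^\gamma\big)^{-1}+\tfrac13,$$ and in the comoving reference frame $$\omega=-\tfrac13\,\mathcal T^\alpha_\alpha\big(\mathcal T_{00}\big)^{-1}+\tfrac13 .$$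
   Context: Indices run over $0,1,2,3$ and repeated indices are summed. The functions $s_i(t)$ depend only on the time coordinate $x^0=t$ and are nowhere zero; $g^{\underline{ij}}=\mathrm{diag}(s_0^{-1},s_1^{-1},s_2^{-1},s_3^{-1})$ is the inverse of $g_{\underline{ij}}$, and indices are raised and lowered with $g^{\underline{ij}}$ and $g_{\underline{ij}}$; $\mathcal T^\alpha_\alpha=g^{\underline{\alpha\beta}}\mathcal T_{\alpha\beta}$. The fluid quantities are defined as follows (Madsen's decomposition of a symmetric tensor $\mathcal T_{ij}$ with respect to $u$ with $u_\alpha u^\alpha=1$): the energy density is $\rho=\mathcal T_{\alpha\beta}u^\alpha u^\beta$; $h_{ij}=g_{\underline{ij}}-u_iu_j$, so $h^\alpha_i=\delta^\alpha_i-u^\alpha u_i$; $q_i=\mathcal T_{\alpha\beta}u^\alpha h^\beta_i$; $\Pi_{ij}=-\mathcal T_{\alpha\beta}h^\alpha_ih^\beta_j$; the pressure is $p=\tfrac13\Pi^\alpha_\alpha=\tfrac13 g^{\underline{ij}}\Pi_{ij}$. The comoving reference frame is the one in which $u_i=\delta_{i0}$ (covariant components); the normalization $u_\alpha u^\alpha=1$ is kept there. *)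

(* Defs.v *)
From HB Require Import structures.
From mathcomp Require Import all_boot all_order all_algebra.
From mathcomp Require Import reals.

Set Implicit Arguments.
Unset Strict Implicit.
Unset Printing Implicit Defensive.

Import Order.TTheory GRing.Theory Num.Theory.
Local Open Scope ring_scope.

(* Index gymnastics at one point of a 4-dimensional spacetime.  Unless said
   otherwise, vectors and matrices hold covariant components: u 0 i is u_i and
   T i j is T_ij.  The argument G is the symmetric part of the metric, G i j
   being g_ij with underlined indices. *)

(* The metric of the spacetime need not be symmetric; indices are raised and
   lowered with its symmetric part only. *)
Definition symmetric_part (R : realType) (g : 'M[R]_4) : 'M[R]_4 :=
  2^-1 *: (g + g^T).

Definition inverse_metric (R : realType) (G : 'M[R]_4) : 'M[R]_4 := invmx G.

(* Contravariant components: raise G u 0 i is u^i. *)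
Definition raise (R : realType) (G : 'M[R]_4) (u : 'rV[R]_4) : 'rV[R]_4 :=
  \row_i \sum_j inverse_metric G i j * u 0 j.

Definition trace (R : realType) (G T : 'M[R]_4) : R :=
  \sum_a \sum_b inverse_metric G a b * T a b.

Definition normalized (R : realType) (G : 'M[R]_4) (u : 'rV[R]_4) : Prop :=
  \sum_a u 0 a * raise G u 0 a = 1.

Definition projector (R : realType) (G : 'M[R]_4) (u : 'rV[R]_4) : 'M[R]_4 :=
  \matrix_(i, j) (G i j - u 0 i * u 0 j).

(* Mixed components: mixed_projector G u a i is h^a_i. *)
Definition mixed_projector (R : realType) (G : 'M[R]_4) (u : 'rV[R]_4) :
    'M[R]_4 :=
  \matrix_(a, i) \sum_k inverse_metric G a k * projector G u k i.

Definition energy_density (R : realType) (G T : 'M[R]_4) (u : 'rV[R]_4) : R :=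
  \sum_a \sum_b T a b * raise G u 0 a * raise G u 0 b.

(* The tensor Pi_ij of the decomposition of T with respect to u. *)
Definition pressure_tensor (R : realType) (G T : 'M[R]_4) (u : 'rV[R]_4) :
    'M[R]_4 :=
  \matrix_(i, j)
    - \sum_a \sum_b T a b * mixed_projector G u a i * mixed_projector G u b j.

Definition pressure (R : realType) (G T : 'M[R]_4) (u : 'rV[R]_4) : R :=
  3^-1 * trace G (pressure_tensor G T u).

(* A point of spacetime is the row vector of its coordinates x^0, ..., x^3;
   here u is a field of covectors. *)
Definition comoving (R : realType) (u : 'rV[R]_4 -> 'rV[R]_4) : Prop :=
  forall x i, u x 0 i = (i == 0)%:R.

(* Main.v *)
(* Regard u_i and u^i as rows u and U, and let D be the inverse of G, so that
   U = u D and u D u^T = 1. The mixed projector is H = 1 - U^T u, whence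
   H D H^T = D - U^T U, while contracting g^ij with T_ab h^a_i h^b_j amounts to
   contracting T with H D H^T. In the comoving frame U G = u is supported on the
   index 0; G being diagonal, so is U, and the normalization gives u^0 = 1. *)
Require Import Defs.
From HB Require Import structures.
From mathcomp Require Import all_boot all_order all_algebra.
From mathcomp Require Import reals.

Set Implicit Arguments.
Unset Strict Implicit.
Unset Printing Implicit Defensive.

Import Order.TTheory GRing.Theory Num.Theory.
Local Open Scope ring_scope.

Section FluidAtAPoint.
Variables (R : realType) (G : 'M[R]_4) (u : 'rV[R]_4).
Hypotheses (G_sym : G^T = G) (G_unit : G \in unitmx) (u_norm : normalized G u).

(** Contractions over two index pairs become traces, so that cyclicity and transposition replace the
    relabelling of summation indices. *)
Lemma contraction_mxtrace (A B : 'M[R]_4) :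
  \sum_a \sum_b A a b * B a b = \tr (A^T *m B).
Proof.
rewrite exchange_big; apply: eq_bigr => b _; rewrite mxE.
by apply: eq_bigr => a _; rewrite mxE.
Qed.

Lemma inverse_metric_sym : (inverse_metric G)^T = inverse_metric G.
Proof. by rewrite /inverse_metric trmx_inv G_sym. Qed.

(** Symmetry of the inverse metric lets the sum over its second index be read as a row times a
    matrix. *)
Lemma raiseE : raise G u = u *m inverse_metric G.
Proof.
apply/rowP => i; rewrite !mxE; apply: eq_bigr => j _.
by rewrite mulrC -[in LHS]inverse_metric_sym mxE.
Qed.

Lemma normalizedE : raise G u *m u^T = 1%:M.
Proof.
apply/matrixP => i j; rewrite !ord1 !mxE eqxx -u_norm.
by apply: eq_bigr => k _; rewrite [u^T _ _]mxE mulrC.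
Qed.

Lemma mixed_projectorE : mixed_projector G u = 1%:M - (raise G u)^T *m u.
Proof.
transitivity (inverse_metric G *m (G - u^T *m u)).
  apply/matrixP => a i; rewrite !mxE; apply: eq_bigr => k _.
  by rewrite !mxE big_ord1 !mxE.
rewrite mulmxBr mulVmx // mulmxA; congr (_ - _ *m _).
by rewrite raiseE trmx_mul inverse_metric_sym.
Qed.

(** The projector kills the velocity: [H D u^T = U^T - U^T (U u^T) = 0] by the normalization. Hence
    the right factor [H^T = 1 - u^T U] acts as the identity on [H D = D - U^T U]. *)
Lemma mixed_projector_inverse_metric :
  mixed_projector G u *m inverse_metric G *m (mixed_projector G u)^T
  = inverse_metric G - (raise G u)^T *m raise G u.
Proof.
have UT : inverse_metric G *m u^T = (raise G u)^T.
  by rewrite raiseE trmx_mul inverse_metric_sym.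
rewrite mixed_projectorE linearB /= trmx1 trmx_mul trmxK.
rewrite mulmxBl mul1mx -mulmxA -raiseE mulmxBr mulmx1 mulmxBl.
rewrite [inverse_metric G *m _]mulmxA UT.
by rewrite -mulmxA [raise G u *m _]mulmxA normalizedE mul1mx subrr subr0.
Qed.

Lemma pressure_tensorE (T : 'M[R]_4) :
  pressure_tensor G T u
  = - ((mixed_projector G u)^T *m T *m mixed_projector G u).
Proof.
(* Only the bilinear shape in [H] matters, so the projector is generalized and [mxE] leaves its
   entries alone. *)
rewrite /pressure_tensor; move: (mixed_projector G u) => H.
apply/matrixP => i j; rewrite !mxE exchange_big; congr (- _).
apply: eq_bigr => b _; rewrite mxE mulr_suml; apply: eq_bigr => a _.
by rewrite [_^T i a]mxE [_ * T a b]mulrC.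
Qed.

Lemma pressureE (T : 'M[R]_4) :
  pressure G T u
  = - 3^-1 * (\sum_a \sum_b T a b *
      (inverse_metric G a b - raise G u 0 a * raise G u 0 b)).
Proof.
have -> : \sum_a \sum_b T a b *
      (inverse_metric G a b - raise G u 0 a * raise G u 0 b)
    = \tr (T^T *m (inverse_metric G - (raise G u)^T *m raise G u)).
  rewrite -contraction_mxtrace; apply: eq_bigr => a _; apply: eq_bigr => b _.
  by rewrite ![in RHS]mxE big_ord1 ![_^T _ _]mxE.
rewrite -mixed_projector_inverse_metric /pressure /trace contraction_mxtrace.
rewrite inverse_metric_sym pressure_tensorE mulmxN raddfN mulrN mulNr.
(* Transposing under the trace turns [T^T] into [T]; cyclicity then carries the leading projector to
   the end. *)
congr (- (_ * _)); rewrite /= -[RHS]mxtrace_tr !trmx_mul !trmxK.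
by rewrite inverse_metric_sym -!mulmxA [RHS]mxtrace_mulC !mulmxA.
Qed.

Lemma pressure_trace (T : 'M[R]_4) :
  pressure G T u = - 3^-1 * (trace G T - energy_density G T u).
Proof.
rewrite pressureE /trace /energy_density -sumrB; congr (_ * _).
apply: eq_bigr => a _; rewrite -sumrB; apply: eq_bigr => b _.
by rewrite mulrBr mulrA [T a b * inverse_metric G a b]mulrC.
Qed.

Lemma energy_density_comoving (T : 'M[R]_4) :
  is_diag_mx G -> (forall i, u 0 i = (i == 0)%:R) ->
  energy_density G T u = T 0 0.
Proof.
move=> /is_diag_mxP G_diag u_com.
(* If [G i i] were zero, row [i] of the diagonal matrix [G] would vanish, and with it the
   determinant. *)
have G_neq0 i : G i i != 0.
  apply: contraTneq G_unit => Gii0; rewrite unitmxE unitfE negbK.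
  rewrite (expand_det_row G i) big1 // => j _.
  by case: (eqVneq i j) => [<-|ij]; rewrite ?Gii0 ?G_diag ?mul0r.
(* Lowering the index again gives a diagonal system for the u^i, so no entry of the inverse metric
   has to be computed. *)
have UG : raise G u *m G = u by rewrite raiseE mulmxKV.
have U_neq0 i : i != 0 -> raise G u 0 i = 0.
  move=> i0; have /rowP/(_ i) := UG; rewrite u_com (negPf i0) mxE.
  rewrite (bigD1 i) //= big1 => [|j ji]; last by rewrite G_diag ?mulr0.
  by move/eqP; rewrite addr0 mulf_eq0 (negPf (G_neq0 i)) orbF => /eqP.
(* Only u_0 u^0 survives in the normalization, and u_0 = 1. *)
have U0 : raise G u 0 0 = 1.
  rewrite -u_norm (bigD1 0) //= big1 => [|i i0]; last by rewrite U_neq0 ?mulr0.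
  by rewrite u_com eqxx mul1r addr0.
rewrite /energy_density (bigD1 0) //= (bigD1 0) //= U0 !mulr1.
rewrite big1 => [|b b0]; last by rewrite (U_neq0 b) ?mulr0.
rewrite big1 ?addr0 // => a a0.
by rewrite big1 // => b _; rewrite (U_neq0 a) ?mulr0 ?mul0r.
Qed.

End FluidAtAPoint.

Theorem lemma3p2 (R : realType) (s : 'I_4 -> R -> R)
    (g T : 'rV[R]_4 -> 'M[R]_4) (u : 'rV[R]_4 -> 'rV[R]_4)
    (s_neq0 : forall i t, s i t != 0)
    (g_diag : forall x, symmetric_part (g x) = diag_mx (\row_i s i (x 0 0)))
    (T_sym : forall x, (T x)^T = T x)
    (u_norm : forall x, normalized (symmetric_part (g x)) (u x)) :
  let G x := symmetric_part (g x) in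
  let ginv x := inverse_metric (G x) in
  let u_up x := raise (G x) (u x) in
  let trT x := trace (G x) (T x) in
  let rho x := energy_density (G x) (T x) (u x) in
  let p x := pressure (G x) (T x) (u x) in
  [/\ forall x,
        p x = - 3^-1 * (\sum_a \sum_b
                T x a b * (ginv x a b - u_up x 0 a * u_up x 0 b)) /\
        p x = - 3^-1 * (trT x - rho x),
      comoving u -> forall x, p x = - 3^-1 * trT x + 3^-1 * T x 0 0,
      forall x, rho x = \sum_a \sum_b T x a b * u_up x 0 a * u_up x 0 b,
      comoving u -> forall x, rho x = T x 0 0
    & forall (omega : 'rV[R]_4 -> R) x,
        p x = omega x * rho x -> rho x != 0 ->
        omega x = - 3^-1 * trT x *
                  (\sum_b \sum_c T x b c * u_up x 0 b * u_up x 0 c)^-1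
                  + 3^-1 /\
        (comoving u -> omega x = - 3^-1 * trT x * (T x 0 0)^-1 + 3^-1)].
Proof.
move=> G ginv u_up trT rho p.
have G_sym x : (G x)^T = G x by rewrite /G g_diag tr_diag_mx.
have G_unit x : G x \in unitmx.
  rewrite unitmxE unitfE /G g_diag det_diag; apply/prodf_neq0 => i _.
  by rewrite mxE.
have p_rho x : p x = - 3^-1 * (trT x - rho x)
  by exact: (pressure_trace (G_sym x) (G_unit x) (u_norm x)).
have rho_com : comoving u -> forall x, rho x = T x 0 0.
  move=> u_com x.
  apply: (energy_density_comoving (G_sym x) (G_unit x) (u_norm x)) => //.
  by rewrite -/(G x) /G g_diag diag_mx_is_diag.
have omegaE (omega : 'rV[R]_4 -> R) x : p x = omega x * rho x -> rho x != 0 ->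
    omega x = - 3^-1 * trT x * (rho x)^-1 + 3^-1.
  (* Multiplied by [rho x], the claim becomes the formula [p_rho] for the pressure. *)
  move=> eos rho_neq0; apply: (mulIf rho_neq0); rewrite -eos p_rho.
  by rewrite mulrDl mulfVK // mulrBr mulNr [- 3^-1 * rho x]mulNr opprK.
split=> // [x|u_com x|omega x eos rho_neq0].
- by split=> //; exact: (pressureE (G_sym x) (G_unit x) (u_norm x)).
- by rewrite p_rho rho_com // mulrBr mulNr [- 3^-1 * T x 0 0]mulNr opprK.
- split; first exact: omegaE.
  by move=> u_com; rewrite -rho_com //; exact: omegaE.
Qed.
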